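(* Let $\varepsilon>0$ be a real number. For each $n\ge 1$, define \[ \mathcal{I}_n=\{I\subseteq[n-1] : \mathrm{alt}(I)>n/2-n^{1-\varepsilon}\}. \] Then \[ \lim_{n\to\infty}\ \max_{I\in\mathcal{I}_n}\left|\frac{n\,\beta^{\mathrm{cyc}}_n(I)}{\beta_n(I)}-1\right| = 0. \]
   Context: $[n]=\{1,\dots,n\}$. $S_n$ is the symmetric group on $[n]$ and $C_n\subseteq S_n$ is the set of permutations consisting of a single cycle of length $n$. The descent set of $\pi\in S_n$ is $D(\pi)=\{i\in[n-1]:\pi(i)>\pi(i+1)\}$. For $I\subseteq[n-1]$, $\beta_n(I)=\#\{\pi\in S_n: D(\pi)=I\}$ and $\beta^{\mathrm{cyc}}_n(I)=\#\{\pi\in C_n: D(\pi)=I\}$. The alternation set of $I\subseteq[n-1]$ is $\mathrm{Alt}(I)=\{i\in[n-2] : |I\cap\{i,i+1\}|=1\}$, and the alternation number is $\mathrm{alt}(I)=|\mathrm{Alt}(I)|$. *)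

(* Defs.v *)
From HB Require Import structures.
From mathcomp Require Import all_boot all_order all_algebra all_fingroup.
From mathcomp Require Import all_classical all_reals all_analysis.

Set Implicit Arguments.
Unset Strict Implicit.
Unset Printing Implicit Defensive.

Import Order.TTheory GRing.Theory Num.Theory.
Import numFieldNormedType.Exports.

Local Open Scope ring_scope.

(* Indices are 0-based: k : 'I_m stands for the element k + 1 of [m]. *)

Definition ord_here (m : nat) (i : 'I_m.-1) : 'I_m := widen_ord (leq_pred m) i.

Lemma ord_next_proof (m : nat) (i : 'I_m.-1) : (i.+1 < m)%N.
Proof. by case: m i => [|m] [i]. Qed.

Definition ord_next (m : nat) (i : 'I_m.-1) : 'I_m := Ordinal (ord_next_proof i).

Definition descent_set (n : nat) (s : 'S_n) : {set 'I_n.-1} :=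
  [set i | (s (ord_next i) < s (ord_here i))%N]%SET.

(* The family of cycles of s (fixed points included) is the single block [n]. *)
Definition full_cycle (n : nat) (s : 'S_n) : bool :=
  porbits s == [set [set: 'I_n]]%SET.

Definition beta (n : nat) (I : {set 'I_n.-1}) : nat :=
  #|[set s : 'S_n | descent_set s == I]%SET|.

Definition beta_cyc (n : nat) (I : {set 'I_n.-1}) : nat :=
  #|[set s : 'S_n | full_cycle s && (descent_set s == I)]%SET|.

Definition Alt (n : nat) (I : {set 'I_n.-1}) : {set 'I_n.-2} :=
  [set i | #|I :&: [set ord_here i; ord_next i]| == 1%N]%SET.

Definition alt (n : nat) (I : {set 'I_n.-1}) : nat := #|Alt I|.

Definition high_alt (R : realType) (eps : R) (n : nat) : {set {set 'I_n.-1}} :=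
  [set I : {set 'I_n.-1} |
    n%:R / 2 - powR n%:R (1 - eps) < (alt I)%:R :> R]%SET.

(* The terms are nonnegative, so starting from 0 gives the true maximum over
   high_alt eps n when that set is nonempty; it is nonempty for all n >= 4
   (the set of odd indices has alt = n - 2). *)
Definition max_dev (R : realType) (eps : R) (n : nat) : R :=
  \big[Num.max/0]_(I in high_alt eps n)
    `|n%:R * (beta_cyc I)%:R / (beta I)%:R - 1|.

(* Main.v *)
Require Import Defs.
From HB Require Import structures.
From mathcomp Require Import all_boot all_order all_algebra all_fingroup.
From mathcomp Require Import all_classical all_reals all_analysis.
From mathcomp Require Import zify ring lra fintype finset.
Import Order.TTheory GRing.Theory Num.Theory.
Import numFieldNormedType.Exports.

Set Implicit Arguments.
Unset Strict Implicit.
Unset Printing Implicit Defensive.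

(** Write D(s) for the descent set of s. For a set J of positions, the
    permutations with D(s) contained in J are in bijection with the words whose
    letters are the blocks cut out by J, each letter occurring as often as its
    block is long ([card_words]). The cyclic permutations with D(s) contained
    in J, together with a starting point, are in bijection with those of these
    words that are primitive, that is, not fixed by a nontrivial rotation
    ([card_primitive_words], the one-cycle case of the Gessel-Reutenauer
    bijection). So for every J, the number of permutations with D(s) contained
    in J minus N times the number of cyclic ones is the number of periodic
    words. Passing from D(s) contained in J to D(s) = I by inclusion-exclusion,
    the difference beta(I) - N beta_cyc(I) is at most the total number of
    periodic words over all J.

    A periodic word has a period q <= N/2 and is determined by its first q
    letters, which again use an initial segment of the alphabet. Such words of
    length q are counted by the ordered Bell numbers, which are at most
    (3/2)^q q!. Hence the difference is at most (N/2) (3/2)^(N/2) (N/2)!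
    ([discrepancy_bound]).

    In the other direction, beta(I) >= N! / (2^a (N - a)!) with a = alt(I)
    ([beta_lower_bound]). Among the permutations with descent set I, the law of
    the last value is, after a monotone run, at most as skewed as if the
    permutation had begun with that run. By a Chebyshev-type inequality every
    alternation therefore multiplies the number of permutations of length k by
    at least (k+1)/2, and every prolongation of a run of length L multiplies it
    by at least (k+1)/(L+2). Altogether this is N! divided by the product of
    the (l+1)! over the lengths l of the runs, and that product is largest when
    all runs but one have length 1.

    When a is at least N/2 - t, these two bounds and the size of the central
    binomial coefficient show that the relative error is at most
    2 (N/2)^2 N^t (3/4)^(N/2) ([deviation_bound]). With t = N^(1-eps) the
    factor N^t is exp(o(N)), so the exponential decay wins, uniformly in I. *)

(** * Growth of the number of permutations with a prescribed pattern of turns *)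

Lemma leq_sum_nat m n (F G : nat -> nat) :
    (forall i, m <= i < n -> F i <= G i) ->
  \sum_(m <= i < n) F i <= \sum_(m <= i < n) G i.
Proof. by move=> leFG; rewrite big_nat [leqRHS]big_nat leq_sum. Qed.

Lemma sum_bin_lt L k : \sum_(0 <= j < k) 'C(j, L) = 'C(k, L.+1).
Proof.
elim: k => [|k IH]; first by rewrite big_geq // bin0n.
by rewrite big_nat_recr //= IH binS addnC.
Qed.

(** If g / 'C(., L) is nonincreasing, so is the ratio of the partial sums of
    g and of 'C(., L), and the latter sums are 'C(., L.+1): the hypothesis on g
    reproduces itself under summation with L increased by one. *)
Lemma sum_ratio_nonincreasing (g : nat -> nat) L n k k' :
    (forall i j, i <= j <= n -> g j * 'C(i, L) <= g i * 'C(j, L)) ->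
    k <= k' <= n.+1 ->
  (\sum_(0 <= j < k') g j) * 'C(k, L.+1) <= (\sum_(0 <= j < k) g j) * 'C(k', L.+1).
Proof.
move=> g_ratio /andP[lekk' lek'n].
rewrite -!sum_bin_lt !(@big_cat_nat _ _ _ k 0 k') //= mulnDl mulnDr leq_add2l.
rewrite mulnC !big_distrlr /=; apply: leq_sum_nat => i lt_ik.
apply: leq_sum_nat => j /andP[le_kj lt_jk']; rewrite mulnC.
by apply: g_ratio; lia.
Qed.

(** The preceding monotonicity compares every partial sum of g with the total;
    summing the comparison gives the growth of the total in one summation step,
    with equality when g is 'C(., L) itself. *)
Lemma sum_partial_sums (g : nat -> nat) L n :
    L <= n ->
    (forall i j, i <= j <= n -> g j * 'C(i, L) <= g i * 'C(j, L)) ->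
  n.+2 * (\sum_(0 <= j < n.+1) g j) <=
    L.+2 * \sum_(0 <= k < n.+2) \sum_(0 <= j < k) g j.
Proof.
move=> leLn g_ratio.
have bin_gt0 : 0 < 'C(n.+1, L.+1) by rewrite bin_gt0.
rewrite -(leq_pmul2r bin_gt0) mulnAC mul_bin_diag -!mulnA leq_mul2l /= mulnC.
rewrite -[X in _ * X <= _]sum_bin_lt big_distrr big_distrl /=; apply: leq_sum_nat => k lt_kn.
by apply: (sum_ratio_nonincreasing g_ratio); lia.
Qed.

(** The number of permutations of n.+1 elements with last value k and a given
    descent pattern, whose changes of direction are marked by [a]; here k is
    counted from the bottom if the last step is an ascent and from the top
    if it is a descent. In this coordinate an ascent and a descent obey the
    same recurrence, and a turn shows up only as a reflection of the previous
    coordinate; see [count_last_oriented]. *)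
Fixpoint last_count (a : nat -> bool) n : nat -> nat :=
  if n is m.+1 then
    fun k => \sum_(0 <= j < k) last_count a m (if a m then m - j else j)
  else fun k => (k == 0).

Fixpoint run_length (a : nat -> bool) n : nat :=
  if n is m.+1 then (if a m then 1 else (run_length a m).+1) else 0.

Lemma run_length_gt0 (a : nat -> bool) n : 0 < run_length a n.+1.
Proof. by rewrite /=; case: (a n). Qed.

Lemma run_length_bound (a : nat -> bool) n :
  ~~ a 0 -> run_length a n + \sum_(0 <= i < n) a i <= n.
Proof.
move=> a0; elim: n => [|n IH]; first by rewrite big_geq.
rewrite big_nat_recr //=; case: n IH => [|n] IH.
  by rewrite (negPf a0) big_geq.
by move: IH (run_length_gt0 a n) => /=; case: (a n); case: (a n.+1) => /=; lia.
Qed.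

(** The invariant behind the lower bound: in the coordinate used for the next
    step, the law of the last value grows at most as fast as 'C(., L), the law
    produced by a run of length L that starts from a uniform value. Right after
    a turn the reflection makes the law nonincreasing, which is the invariant
    for L = 0. *)
Lemma last_count_ratio (a : nat -> bool) n :
  let g j := last_count a n (if a n then n - j else j) in
  let L := if a n then 0 else run_length a n in
  forall i j, i <= j <= n -> g j * 'C(i, L) <= g i * 'C(j, L).
Proof.
elim: n => [|n IH] /= i j /andP[leij lejn].
  have [-> ->] : i = 0 /\ j = 0 by lia.
  by case: (a 0).
have S_ratio k k' : k <= k' <= n.+1 ->
    last_count a n.+1 k' * 'C(k, run_length a n.+1) <=
    last_count a n.+1 k * 'C(k', run_length a n.+1).
  move=> le_kk'; have := sum_ratio_nonincreasing IH le_kk'.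
  by rewrite /=; case: (a n).
case: (a n.+1); last by apply: S_ratio; lia.
rewrite !bin0 !muln1.
rewrite [leqRHS](@big_cat_nat _ _ _ (n.+1 - j)) //=; [exact: leq_addr|lia].
Qed.

Lemma last_count_step (a : nat -> bool) n :
    ~~ a 0 ->
  n.+2 * (\sum_(0 <= j < n.+1) last_count a n j) <=
  (if a n then 2 else (run_length a n).+2)
    * \sum_(0 <= j < n.+2) last_count a n.+1 j.
Proof.
move=> a0; have leL : (if a n then 0 else run_length a n) <= n.
  by case: (a n) => //; have := run_length_bound n a0; lia.
have := sum_partial_sums leL (@last_count_ratio a n).
rewrite /=; case: (a n) => //=; rewrite [X in _ * X <= _]big_nat_rev /= add0n.
by under eq_big_nat => j /andP[_ lt_jn] do rewrite subSS subKn //.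
Qed.

(** The telescoped step bounds would give one factorial per run. The single
    factorial in this weaker form suffices and survives the induction because
    the current run has length at most n minus the number of turns. *)
Lemma last_count_total (a : nat -> bool) n :
    ~~ a 0 ->
  n.+1`! <= (\sum_(0 <= k < n.+1) last_count a n k)
            * (2 ^ (\sum_(0 <= i < n) a i) * (n.+1 - \sum_(0 <= i < n) a i)`!).
Proof.
move=> a0; elim: n => [|n IH]; first by rewrite big_nat1 big_geq.
have := last_count_step n a0; have := run_length_bound n a0.
move: IH; rewrite [\sum_(0 <= i < n.+1) a i]big_nat_recr //=.
set A := \sum_(0 <= i < n) a i; set T := \sum_(0 <= k < n.+1) _.
set T' := \sum_(0 <= k < n.+2) _; set L := run_length a n.
move=> IH bound step.
rewrite factS; apply: leq_trans (leq_mul (leqnn _) IH) _.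
rewrite mulnA; apply: leq_trans (leq_mul step (leqnn _)) _.
case: (a n) step => _ /=.
  by rewrite addn1 subSS expnS -!mulnA leq_eqVlt; apply/orP; left; apply/eqP; ring.
rewrite addn0 [n.+2 - A]subSn ?[(n.+1 - A).+1`!]factS; last by lia.
rewrite [leqRHS](_ : _ = (n.+1 - A).+1 * T' * (2 ^ A * (n.+1 - A)`!)).
  by rewrite !leq_mul2r; apply/orP; right; apply/orP; right; lia.
by set M := _.+1; ring.
Qed.

(** * Permutations counted by descent pattern and last value *)

Lemma lift_perm_inj n (i j : 'I_n.+1) : injective (@lift_perm n i j).
Proof.
move=> s t eq_st; apply/permP=> k; apply: (@lift_inj _ j).
by rewrite -!(lift_perm_lift i) eq_st.
Qed.

Lemma lift_perm_surj n (i : 'I_n.+1) (s : 'S_n.+1) :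
  exists t, s = lift_perm i (s i) t.
Proof.
pose f k := odflt k (unlift (s i) (s (lift i k))).
have fE k : lift (s i) (f k) = s (lift i k).
  rewrite /f; have := neq_lift i k.
  by rewrite -(can_eq (permK s)) => /unlift_some[k' -> ->].
have f_inj : injective f.
  move=> k1 k2 eq_f; apply: (@lift_inj _ i); apply: (@perm_inj _ s).
  by rewrite -!fE eq_f.
exists (perm f_inj); apply/permP => k.
case: (unliftP i k) => [k'|] ->; last by rewrite lift_perm_id.
by rewrite lift_perm_lift permE fE.
Qed.

Lemma val_lift_max n (i : 'I_n) : lift (ord_max : 'I_n.+1) i = i :> nat.
Proof. by rewrite /= /bump leqNgt ltn_ord. Qed.

Definition has_descents (d : nat -> bool) n (s : 'S_n.+1) : bool :=
  [forall i : 'I_n, (s (ord_next (m := n.+1) i) < s (ord_here (m := n.+1) i)) == d i].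

Definition count_last d n (k : nat) : nat :=
  #|[set s : 'S_n.+1 | has_descents d s && (s ord_max == k :> nat)]|.

Lemma has_descents_lift d n (k : 'I_n.+2) (t : 'S_n.+1) :
  has_descents d (lift_perm ord_max k t) =
    has_descents d t && ((k <= t ord_max) == d n).
Proof.
have here_last : ord_here (m := n.+2) ord_max = lift ord_max ord_max.
  by apply/ord_inj; rewrite val_lift_max.
have next_last : ord_next (m := n.+2) ord_max = ord_max by apply/val_inj.
have bumpk (x : 'I_n.+1) : (k < bump k x) = (k <= x).
  by rewrite /bump; case: leqP => /= ?; lia.
apply/forallP/andP => [desc|[/forallP desc last_desc] i].
- split; last first.
    have := desc ord_max.
    by rewrite here_last next_last lift_perm_id lift_perm_lift /= bumpk.
  apply/forallP => i; have := desc (widen_ord (leqnSn n) i).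
  have -> : ord_here (m := n.+2) (widen_ord (leqnSn n) i)
            = lift ord_max (ord_here (m := n.+1) i).
    by apply/ord_inj; rewrite val_lift_max.
  have -> : ord_next (m := n.+2) (widen_ord (leqnSn n) i)
            = lift ord_max (ord_next (m := n.+1) i).
    by apply/ord_inj; rewrite val_lift_max.
  by rewrite !lift_perm_lift /= ltnNge leq_bump2 -ltnNge.
have bump_max (i' : 'I_n) : bump n i' = i' by rewrite /bump leqNgt ltn_ord.
case: (unliftP ord_max i) => [i'|] ->; last first.
  by rewrite here_last next_last lift_perm_id lift_perm_lift /= bumpk.
have := desc i'.
have -> : ord_here (m := n.+2) (lift ord_max i')
          = lift ord_max (ord_here (m := n.+1) i').
  by apply/ord_inj; rewrite val_lift_max /= bump_max.
have -> : ord_next (m := n.+2) (lift ord_max i')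
          = lift ord_max (ord_next (m := n.+1) i').
  by apply/ord_inj; rewrite val_lift_max /= bump_max.
rewrite !lift_perm_lift /= [bump _ (t _) < _]ltnNge leq_bump2 -ltnNge.
by rewrite bump_max.
Qed.

(** Deleting the last value k and standardizing is a bijection, inverse to
    [lift_perm ord_max k]; the last step descends exactly when the previous
    last value is at least k after standardization. *)
Lemma count_last_rec d n k : k <= n.+1 ->
  count_last d n.+1 k =
    \sum_(0 <= j < n.+1 | (k <= j) == d n) count_last d n j.
Proof.
move=> le_kn; pose k' : 'I_n.+2 := Ordinal (le_kn : k < n.+2).
transitivity #|[set t : 'S_n.+1 | has_descents d t && ((k <= t ord_max) == d n)]|.
  rewrite -(card_imset _ (@lift_perm_inj _ ord_max k')); apply: eq_card => s.
  rewrite !inE; apply/andP/imsetP => [[desc /eqP last_s]|[t]].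
    have [t def_s] := lift_perm_surj ord_max s.
    have {}last_s : s ord_max = k' by apply/val_inj.
    exists t; last by rewrite def_s last_s.
    by move: desc; rewrite def_s last_s has_descents_lift inE.
  by rewrite inE -(has_descents_lift _ k') => desc ->; rewrite lift_perm_id.
rewrite big_mkord /= -sum1dep_card.
rewrite (partition_big (fun t : 'S_n.+1 => t ord_max) (fun j => (k <= j) == d n)) /=.
  apply: eq_bigr => j kj; rewrite /count_last -sum1dep_card; apply: eq_bigl => t.
  case: (t ord_max =P j) => [->|neq]; first by rewrite eqxx kj !andbT.
  by rewrite andbF; apply/esym/negbTE; apply/nandP; right; apply/eqP => /val_inj.
by move=> t /andP[].
Qed.

Definition turn (d : nat -> bool) i : bool := (0 < i) && (d i != d i.-1).

(** Position 0 never counts as a turn, so for n = 0 the orientation is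
    immaterial. *)
Lemma count_last_oriented d n k : k <= n ->
  count_last d n k =
    last_count (turn d) n (if (0 < n) && d n.-1 then n - k else k).
Proof.
elim: n k => [|n IH] k.
  rewrite leqn0 => /eqP->; rewrite /count_last /=.
  transitivity #|{: 'S_1}|; last by rewrite card_Sn.
  apply: eq_card => s; rewrite !inE (ord1 (s _)) eqxx andbT.
  by apply/forallP => -[].
move=> le_kn; rewrite count_last_rec //=.
have step j : j <= n ->
    count_last d n j = if (0 < n) && d n.-1 then last_count (turn d) n (n - j)
                       else last_count (turn d) n j.
  by move=> le_jn; rewrite IH //; case: ifP.
case: (boolP (d n)) => dn /=.
  rewrite (@big_cat_nat _ _ _ k) //= big1_seq => [|i]; last first.
    by rewrite mem_index_iota; case: leqP => //=; lia.
  rewrite add0n big_mkcond /= big_nat_rev /=.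
  rewrite -{1}[k]add0n big_addn; apply: eq_big_nat => j lt_j.
  rewrite ifT; last by lia.
  rewrite step; last by lia.
  rewrite /turn dn; case: (posnP n) => [n0|n_gt0] /=.
    by congr last_count; lia.
  by case: (d n.-1) => /=; congr last_count; lia.
rewrite (@big_cat_nat _ _ _ k) //= [X in _ + X = _]big1_seq => [|i]; last first.
  by rewrite mem_index_iota; case: leqP => //=; lia.
rewrite addn0 big_mkcond /=; apply: eq_big_nat => j lt_j.
rewrite ifT; last by lia.
rewrite step; last by lia.
by rewrite /turn (negPf dn); case: (posnP n) => [->//|n_gt0] /=; case: (d n.-1).
Qed.

Definition mem_nat n (I : {set 'I_n.+1}) (i : nat) : bool := inord i \in I.

Lemma descent_setE n (I : {set 'I_n.+1}) (s : 'S_n.+2) :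
  (@descent_set n.+2 s == I) = has_descents (mem_nat I) s.
Proof.
apply/eqP/forallP => [<- i|desc]; first by rewrite /mem_nat inord_val inE.
by apply/setP => i; rewrite inE (eqP (desc i)) /mem_nat inord_val.
Qed.

Lemma alt_turns n (I : {set 'I_n.+1}) :
  @alt n.+2 I = \sum_(0 <= i < n.+1) turn (mem_nat I) i.
Proof.
rewrite big_nat_recl // add0n big_mkord /alt cardE -sum1_size.
rewrite -[LHS]/(\sum_(i <- enum _) 1) big_enum /= big_mkcond /=; apply: eq_bigr => i _.
rewrite inE /turn /= /mem_nat.
have -> : inord i.+1 = ord_next (m := n.+1) i by apply/ord_inj; rewrite inordK //= ltnS.
have -> : inord i = ord_here (m := n.+1) i.
  by apply/ord_inj; rewrite inordK //= ltnW // ltnS.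
have neq_xy : ord_here (m := n.+1) i != ord_next (m := n.+1) i.
  by apply/eqP => /(congr1 val) /= /eqP; rewrite (ltn_eqF (ltnSn _)).
move: neq_xy; set x := ord_here _; set y := ord_next _ => neq_xy.
have -> : #|I :&: [set x; y]%SET| = (x \in I) + (y \in I).
  rewrite setIUr cardsU.
  have -> : (I :&: [set x] :&: (I :&: [set y]) = set0)%SET.
    apply/setP => z; rewrite !inE.
    by case: (z =P x) => [->|_]; rewrite ?(negPf neq_xy) ?andbF.
  rewrite cards0 subn0.
  have cardI1 z : #|I :&: [set z]%SET| = (z \in I).
    case: (boolP (z \in I)) => zI; first by rewrite (setIidPr _) ?cards1 ?sub1set.
    apply/eqP; rewrite cards_eq0; apply/eqP/setP => u; rewrite !inE.
    by apply/negbTE/negP => /andP[uI /eqP eq_uz]; rewrite -eq_uz uI in zI.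
  by rewrite !cardI1.
by case: (x \in I); case: (y \in I).
Qed.

(** Summing over the last value does not depend on the end from which it is
    counted, so the oriented counts add up to [beta]. *)
Lemma beta_lower_bound n (I : {set 'I_n.+1}) :
  n.+2`! <= @beta n.+2 I * (2 ^ @alt n.+2 I * (n.+2 - @alt n.+2 I)`!).
Proof.
rewrite alt_turns; set d := mem_nat I.
suff -> : @beta n.+2 I = \sum_(0 <= k < n.+2) last_count (turn d) n.+1 k.
  exact: last_count_total.
transitivity (\sum_(0 <= k < n.+2) count_last d n.+1 k).
  rewrite big_mkord /beta -sum1dep_card.
  rewrite (partition_big (fun s : 'S_n.+2 => s ord_max) predT) //=.
  apply: eq_bigr => k _; rewrite /count_last -sum1dep_card; apply: eq_bigl => s.
  by rewrite descent_setE.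
have [dn|dn] := boolP (d n).
  rewrite [RHS]big_nat_rev; apply: eq_big_nat => k lt_k.
  by rewrite count_last_oriented /= ?dn //; congr last_count; lia.
apply: eq_big_nat => k lt_k.
by rewrite count_last_oriented /= ?(negPf dn).
Qed.

(** * Ordered set partitions *)

(** The inductive step for the bound (3/2)^a a! on ordered Bell numbers. It
    amounts to exp(2/3) - 1 < 1; the extra term 2^a makes the induction on a
    close. *)
Lemma sum_bin_pow_fact a : 0 < a ->
  2 * (\sum_(1 <= k < a.+1) 'C(a, k) * (2 ^ k * 3 ^ (a - k) * (a - k)`!)) + 2 ^ a
    <= 2 * (3 ^ a * a`!).
Proof.
elim: a => [//|[_ _|a IH _]]; first by rewrite big_nat1.
rewrite big_nat_recr //= binn subnn fact0 expn0 !muln1 mul1n.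
have -> : \sum_(1 <= k < a.+2) 'C(a.+2, k) * (2 ^ k * 3 ^ (a.+2 - k) * (a.+2 - k)`!)
   = (3 * a.+2) * \sum_(1 <= k < a.+2) 'C(a.+1, k) * (2 ^ k * 3 ^ (a.+1 - k) * (a.+1 - k)`!).
  rewrite big_distrr /=; apply: eq_big_nat => k lt_k.
  have Ek : 'C(a.+2, k) * (a.+2 - k)`! = a.+2 * ('C(a.+1, k) * (a.+1 - k)`!).
    have k_gt0 : 0 < k`! by rewrite fact_gt0.
    apply/eqP; rewrite -(eqn_pmul2r k_gt0) -!mulnA ![_`! * k`!]mulnC.
    by rewrite !bin_fact ?factS //; lia.
  rewrite [in 3 ^ (a.+2 - k)]subSn; last by lia.
  rewrite expnS; move: Ek.
  set x := 'C(a.+2, k); set y := 'C(a.+1, k); set p := 2 ^ k; set q := 3 ^ _.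
  set f := _`!; set g := _`! => Ek.
  by transitivity (3 * p * q * (x * f)); [ring|rewrite Ek; ring].
have := IH isT; set u := \sum_(_ <= _ < _) _.
rewrite [a.+2`!]factS ![_ ^ a.+2]expnS.
set v := 2 ^ a.+1; set w := 3 ^ a.+1; set f := a.+1`!.
by nia.
Qed.

Section Packed.

Variables (T : finType) (N : nat).
Implicit Types (A Z : {set T}) (w : {ffun T -> 'I_N.+1}).

(** The words on the index set A whose letters form an initial segment of the
    alphabet, that is, the ordered set partitions of A. Requiring the letter 0
    outside A keeps all index sets inside one finite type. *)
Definition packed_on A w :=
  [forall x, if x \in A then [forall v : 'I_N.+1, (v < w x) ==> [exists y in A, w y == v]]
             else w x == ord0].

Definition num_packed A := #|[set w | packed_on A w]|.

Lemma packed_onP A w :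
  reflect ((forall x, x \in A -> forall v, v < w x -> exists2 y, y \in A & w y = v :> nat)
           /\ forall x, x \notin A -> w x = ord0)
          (packed_on A w).
Proof.
apply: (iffP forallP) => [pw|[pA p0] x].
  split=> x xA; last by have := pw x; rewrite (negPf xA) => /eqP.
  move=> v lt_v; have := pw x; rewrite xA => /forallP/(_ (inord v)).
  have lt_vN : v < N.+1 by apply: ltn_trans lt_v _.
  rewrite inordK // lt_v /= => /exists_inP[y yA /eqP wy]; exists y => //.
  by rewrite wy inordK.
case: (boolP (x \in A)) => xA; last by rewrite p0.
apply/forallP => v; apply/implyP => /(pA _ xA)[y yA wy].
by apply/exists_inP; exists y => //; apply/eqP/ord_inj.
Qed.

(** Z is the first block of the ordered partition; removing it and lowering
    the other letters by one leaves an ordered partition of the complement. *)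
Lemma num_packed_rec A : A != set0 ->
  num_packed A <= \sum_(Z : {set T} | (Z != set0) && (Z \subset A)) num_packed (A :\: Z).
Proof.
move=> A_n0; rewrite /num_packed -sum1_card.
pose zeros w := [set x in A | w x == ord0]%SET.
rewrite (partition_big zeros (fun Z => (Z != set0) && (Z \subset A))) /=; last first.
  move=> w; rewrite inE => /packed_onP[pA _]; apply/andP; split; last first.
    by apply/subsetP => x; rewrite inE => /andP[].
  have /set0Pn[x xA] := A_n0; apply/set0Pn.
  case: (posnP (w x)) => [wx0|/(pA _ xA)[y yA wy0]].
    by exists x; rewrite inE xA; apply/eqP/ord_inj.
  by exists y; rewrite inE yA; apply/eqP/ord_inj.
apply: leq_sum => Z /andP[_ sZA]; rewrite sum1dep_card.
pose shift w : {ffun T -> 'I_N.+1} := [ffun x => inord (w x).-1].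
have shiftE w x : shift w x = (w x).-1 :> nat.
  by rewrite ffunE inordK // (leq_ltn_trans (leq_pred _)).
rewrite -(card_in_imset (f := shift)); last first.
  move=> w1 w2; rewrite !inE.
  move=> /andP[/packed_onP[_ w1_0] /eqP z1] /andP[/packed_onP[_ w2_0] /eqP z2] eq_s.
  apply/ffunP => x; case: (boolP (x \in A)) => xA; last by rewrite w1_0 ?w2_0.
  have : (w1 x == ord0) = (w2 x == ord0).
    by move/setP/(_ x): z1; rewrite -z2 !inE xA.
  have := congr1 (fun w => w x : nat) eq_s; rewrite /= !shiftE => eq_pred.
  rewrite -!val_eqE /= => eq0; apply/ord_inj.
  by case: (nat_of_ord (w1 x)) (nat_of_ord (w2 x)) eq_pred eq0 => [|i] [|j] //= ->.
apply: subset_leq_card; apply/subsetP => _ /imsetP[w + ->]; rewrite !inE.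
move=> /andP[/packed_onP[pA p0] /eqP zw].
have zwE x : x \in A -> (x \in Z) = (w x == 0 :> nat) by move=> xA; rewrite -zw inE xA.
apply/packed_onP; split=> x; rewrite !inE.
  case/andP => xZ xA v; rewrite shiftE => lt_v.
  have [|y yA wy] := pA x xA v.+1; first by lia.
  by exists y; rewrite ?shiftE ?wy // inE yA (zwE _ yA) wy.
rewrite negb_and negbK => xZA; apply/ord_inj; rewrite shiftE /=.
case: (boolP (x \in A)) xZA => [xA|xA _]; last by rewrite p0.
by rewrite orbF zwE // => /eqP->.
Qed.

Lemma num_packed_bound A : 2 ^ #|A| * num_packed A <= 3 ^ #|A| * (#|A|)`!.
Proof.
move: {2}_.+1 (ltnSn #|A|) => m; elim: m A => // m IH A; rewrite ltnS => leAm.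
case: (eqVneq A set0) => [->|A_n0].
  rewrite cards0 !expn0 !mul1n.
  rewrite -[leqRHS](cards1 ([ffun _ => ord0] : {ffun T -> 'I_N.+1})).
  apply: subset_leq_card; apply/subsetP => w; rewrite !inE => /packed_onP[_ w0].
  by apply/eqP/ffunP => x; rewrite ffunE w0 // inE.
have A_gt0 : 0 < #|A| by rewrite card_gt0.
apply: leq_trans (leq_mul (leqnn _) (num_packed_rec A_n0)) _.
rewrite big_distrr /=; set a := #|A| in leAm A_gt0 *.
pose F k := 2 ^ k * 3 ^ (a - k) * (a - k)`!.
apply: (@leq_trans (\sum_(Z : {set T} | (Z != set0) && (Z \subset A)) F #|Z|)).
  apply: leq_sum => Z /andP[Z_n0 sZA].
  have cardD : #|A :\: Z| = a - #|Z| by rewrite cardsD (setIidPr sZA).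
  have Z_gt0 : 0 < #|Z| by rewrite card_gt0.
  have leZA : #|Z| <= a by apply: subset_leq_card.
  have := IH (A :\: Z); rewrite cardD => /(_ _) le_IH.
  rewrite -{1}(subnKC leZA) expnD /F -!mulnA leq_mul2l; apply/orP; right.
  by apply: le_IH; lia.
rewrite (partition_big (fun Z : {set T} => inord #|Z| : 'I_a.+1) (fun k => 0 < k)) /=; last first.
  move=> Z /andP[Z_n0 sZA].
  by rewrite inordK ?card_gt0 // ltnS subset_leq_card.
have le_sum := sum_bin_pow_fact A_gt0.
rewrite -(@leq_pmul2l 2) // (leq_trans _ le_sum) // (leq_trans _ (leq_addr _ _)) //.
rewrite leq_mul2l /= big_geq_mkord /=; apply: leq_sum => k k_gt0.
rewrite -cards_draws -sum1dep_card big_distrl /= leq_eqVlt; apply/orP; left.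
rewrite mul1n; apply/eqP.
apply: congr_big => // Z => [|/andP[/andP[_ sZA] /eqP<-]].
  case: (boolP (Z \subset A)) => sZA; rewrite ?andbF //= andbT.
  have -> : (inord #|Z| == k) = (#|Z| == k :> nat).
    by rewrite -val_eqE /= inordK // ltnS subset_leq_card.
  rewrite -cards_eq0 andbC.
  by case: eqP => // ->; rewrite -lt0n k_gt0.
by rewrite /F inordK // ltnS subset_leq_card.
Qed.

End Packed.

(** * Words and descent sets *)

Lemma rank_perm m (K : 'I_m -> nat) : injective K ->
  exists r : 'S_m, forall p q, (r p < r q) = (K p < K q).
Proof.
move=> K_inj.
have rank_lt p : #|[set q | K q < K p]%SET| < m.
  rewrite -[X in _ < X]card_ord -cardsT; apply: proper_card; apply/properP; split.
    exact/subsetP.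
  by exists p; rewrite !inE ?ltnn.
have rank_mono p q : K p < K q ->
    #|[set x | K x < K p]%SET| < #|[set x | K x < K q]%SET|.
  move=> lt_pq; apply: proper_card; apply/properP; split.
    by apply/subsetP => x; rewrite !inE => /ltn_trans; apply.
  by exists p; rewrite !inE ?ltnn.
pose f p := Ordinal (rank_lt p).
have f_mono p q : (f p < f q) = (K p < K q).
  apply/idP/idP => [|/rank_mono //]; apply: contraLR; rewrite -!leqNgt leq_eqVlt.
  by case/orP=> [/eqP/K_inj->//|/rank_mono/ltnW].
have f_inj : injective f.
  move=> p q eq_f; apply: K_inj; apply/eqP; rewrite eqn_leq.
  by apply/andP; split; rewrite leqNgt -f_mono eq_f ltnn.
by exists (perm f_inj) => p q; rewrite !permE f_mono.
Qed.

(** If f i < g i, then fewer indices have g <= f i than have f <= f i, which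
    is impossible for rearrangements of each other. *)
Lemma sorted_rearrangement_le m (f g : 'I_m -> nat) (s : 'S_m) :
    {homo f : i j / i <= j} -> {homo g : i j / i <= j} ->
    (forall i, f i = g (s i)) ->
  forall i, g i <= f i.
Proof.
move=> f_mono g_mono fg i; rewrite leqNgt; apply/negP => lt_fg.
have : #|[set j | f j <= f i]%SET| <= #|[set j : 'I_m | j < i]%SET|.
  rewrite -(card_imset _ (@perm_inj _ s)); apply: subset_leq_card.
  apply/subsetP => _ /imsetP[j + ->]; rewrite !inE fg => le_g.
  by rewrite ltnNge; apply/negP => /g_mono; lia.
rewrite leqNgt => /negP; apply; apply: proper_card; apply/properP; split.
  by apply/subsetP => j; rewrite !inE => /ltnW/f_mono.
by exists i; rewrite !inE ?ltnn.
Qed.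

Lemma sorted_rearrangement m (f g : 'I_m -> nat) (s : 'S_m) :
    {homo f : i j / i <= j} -> {homo g : i j / i <= j} ->
    (forall i, f i = g (s i)) ->
  f =1 g.
Proof.
move=> f_mono g_mono fg i; apply/eqP; rewrite eqn_leq.
rewrite (sorted_rearrangement_le f_mono g_mono fg) andbT.
apply: (@sorted_rearrangement_le _ _ _ (s^-1)) => // j.
by rewrite fg permKV.
Qed.

Lemma increasing_perm_id m (s : 'S_m) :
  (forall i j : 'I_m, i < j -> s i < s j) -> s = 1%g.
Proof.
move=> s_inc; apply/permP => i; rewrite perm1; apply/ord_inj.
apply: (@sorted_rearrangement m (fun i => s i) (fun i => i) s) => // j k.
by rewrite leq_eqVlt => /orP[/eqP/ord_inj->//|/s_inc/ltnW].
Qed.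

Section Words.

Variable n : nat.
Implicit Types (J : {set 'I_n}) (s : 'S_n.+1) (i : 'I_n.+1).
Implicit Type w : {ffun 'I_n.+1 -> 'I_n.+1}.

Local Notation here := (@ord_here n.+1).
Local Notation next := (@ord_next n.+1).
Local Notation descents s := (@descent_set n.+1 s).

Lemma consecutive i i' : i.+1 = i' -> exists j : 'I_n, i = here j /\ i' = next j.
Proof.
move=> eq_i; have lt_in : i < n by have := ltn_ord i'; lia.
by exists (Ordinal lt_in); split; apply/ord_inj.
Qed.

(** The positions fall into maximal intervals without a boundary in J, numbered
    from the left; this is the number of the interval containing i. *)
Definition block J i : 'I_n.+1 := inord #|[set j in J | j < i]%SET|.

Lemma blockE J i : block J i = #|[set j in J | j < i]%SET| :> nat.
Proof.
rewrite /block inordK // ltnS -[X in _ <= X]card_ord; exact: max_card.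
Qed.

Lemma block_homo J : {homo block J : i i' / i <= i'}.
Proof.
move=> i i' le_ii'; rewrite !blockE; apply: subset_leq_card.
by apply/subsetP => j; rewrite !inE => /andP[-> /=] /leq_trans; apply.
Qed.

Lemma block_next J (j : 'I_n) : block J (next j) = (j \in J) + block J (here j) :> nat.
Proof.
rewrite !blockE (cardsD1 j) !inE /= ltnSn andbT; congr (_ + _).
apply: eq_card => k; rewrite !inE -val_eqE /=; case: (k \in J); rewrite ?andbF //=.
by lia.
Qed.

Lemma descents_subP J s :
  reflect (forall i i', i < i' -> block J i = block J i' -> s i < s i')
          (descents s \subset J).
Proof.
apply: (iffP subsetP) => [sDJ | inc j].
  suff H m : forall i i', i < i' <= i + m -> block J i = block J i' -> s i < s i'.
    by move=> i i' lt_ii'; apply: (H i'); rewrite lt_ii' leq_addl.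
  elim: m => [|m IH] i i' /andP[lt_ii' le_i'm] eqb; first by lia.
  have lt_pi' : i'.-1 < n.+1 by have := ltn_ord i'; lia.
  pose p : 'I_n.+1 := Ordinal lt_pi'.
  have pi' : p.+1 = i' by rewrite /=; lia.
  have [j [def_p def_i']] := consecutive pi'.
  have le_ip : i <= p by rewrite /=; lia.
  have le_pi' : p <= i' by rewrite /=; lia.
  have eqbp : block J p = block J i'.
    apply/ord_inj/eqP; rewrite eqn_leq block_homo //= -eqb.
    exact: block_homo.
  have lt_s : s p < s i'.
    rewrite ltn_neqAle; apply/andP; split.
      by apply/eqP => /ord_inj/perm_inj/(congr1 val)/=; lia.
    have j_notJ : j \notin J.
      move: (block_next J j); rewrite -def_p -def_i' eqbp; case: (j \in J) => //; lia.
    have : j \notin descents s by apply: contra j_notJ; apply: sDJ.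
    by rewrite inE -leqNgt def_p def_i'.
  move: le_ip; rewrite leq_eqVlt => /orP[/eqP/ord_inj->//|lt_ip].
  apply: ltn_trans lt_s; apply: IH; last by rewrite eqb eqbp.
  by rewrite lt_ip /=; lia.
rewrite inE; apply: contraTT => jJ; rewrite -leqNgt ltnW // inc //=.
by apply/ord_inj; rewrite block_next (negPf jJ).
Qed.

Definition words J : {set {ffun 'I_n.+1 -> 'I_n.+1}} :=
  [set w : {ffun 'I_n.+1 -> 'I_n.+1} |
    [exists s : 'S_n.+1, [forall p, w p == block J (s p)]]]%SET.

Lemma wordsP J w : reflect (exists s : 'S_n.+1, forall p, w p = block J (s p)) (w \in words J).
Proof.
rewrite inE; apply: (iffP existsP) => -[s sP]; exists s.
  by move=> p; apply/eqP; apply: (forallP sP).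
by apply/forallP => p; rewrite sP.
Qed.

(** [r] ranks the positions compatibly with their letters, so reading the word
    in the order of the ranks yields the sorted word, which is [block J]. *)
Lemma word_sorted J w (r : 'S_n.+1) : w \in words J ->
    (forall p q, r p < r q -> w p <= w q) ->
  forall p, w p = block J (r p).
Proof.
move=> /wordsP[s ws] r_mono p; apply/ord_inj.
have := @sorted_rearrangement _ (fun i => w (r^-1%g i)) (block J) (r^-1 * s)%g.
move=> /(_ _ (@block_homo J) _ (r p)); rewrite permK; apply.
  move=> i i' /=; rewrite leq_eqVlt => /orP[/eqP/ord_inj->//|lt_ii'].
  by apply: r_mono; rewrite !permKV.
by move=> i; rewrite ws permM.
Qed.

(** A permutation increasing on every block sends the j-th block to the set of
    positions of the letter j, and is determined by these sets. Conversely a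
    word is turned into a permutation by sorting its positions by letter, ties
    being broken from left to right. *)
Lemma card_words J : #|[set s : 'S_n.+1 | descents s \subset J]%SET| = #|words J|.
Proof.
pose f s : {ffun 'I_n.+1 -> 'I_n.+1} := [ffun p => block J (s^-1%g p)].
rewrite -(card_in_imset (f := f)); last first.
  move=> s1 s2; rewrite !inE => /descents_subP D1 /descents_subP D2 eq_f.
  have eqb p : block J (s1^-1%g p) = block J (s2^-1%g p).
    by have := congr1 (fun w : {ffun 'I_n.+1 -> 'I_n.+1} => w p) eq_f; rewrite !ffunE.
  suff : (s1 * s2^-1 = 1)%g by move/(canRL (mulgKV _)); rewrite mul1g.
  apply: increasing_perm_id => i j lt_ij; rewrite !permM.
  have eqbi k : block J (s2^-1%g (s1 k)) = block J k by rewrite -eqb permK.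
  rewrite ltnNge leq_eqVlt; apply/negP => /orP[/eqP/ord_inj/perm_inj/perm_inj eq_ij|lt_ji].
    by rewrite eq_ij ltnn in lt_ij.
  have eq_b : block J j = block J i.
    apply/ord_inj/eqP; rewrite eqn_leq (block_homo J (ltnW lt_ij)) andbT.
    by rewrite -(eqbi i) -(eqbi j); apply/block_homo/ltnW.
  have := D2 _ _ lt_ji; rewrite !eqbi eq_b => /(_ erefl); rewrite !permKV.
  by have := D1 _ _ lt_ij; rewrite eq_b => /(_ erefl); lia.
apply: eq_card => w; apply/imsetP/idP => [[s _ ->]|wJ].
  by apply/wordsP; exists s^-1%g => p; rewrite ffunE.
(* The key encodes the lexicographic order on (letter, position). *)
have [|r rP] := @rank_perm _ (fun p : 'I_n.+1 => w p * n.+1 + p).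
  move=> p q /= eq_pq; apply/ord_inj.
  by have := congr1 (modn^~ n.+1) eq_pq; rewrite /= !modnMDl !modn_small.
have w_le p q : r p < r q -> w p <= w q.
  rewrite rP => lt_pq; rewrite leqNgt; apply/negP => lt_wqp.
  have : w p * n.+1 >= (w q).+1 * n.+1 by rewrite leq_mul2r lt_wqp orbT.
  by rewrite mulSn; have := ltn_ord q; lia.
have wE := word_sorted wJ w_le.
exists r^-1%g; last by apply/ffunP => p; rewrite ffunE invgK wE.
rewrite inE; apply/descents_subP => i i' lt_ii' eq_b.
have := rP (r^-1%g i) (r^-1%g i'); rewrite !wE !permKV eq_b lt_ii' ltn_add2l.
by move/esym.
Qed.

End Words.

(** * Cyclic permutations and primitive words *)

Section Necklaces.

Variable n : nat.
Implicit Types (J : {set 'I_n}) (s : 'S_n.+1) (i x y : 'I_n.+1).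
Implicit Type w : {ffun 'I_n.+1 -> 'I_n.+1}.

Local Notation descents s := (@descent_set n.+1 s).
Local Notation full_cycle s := (@full_cycle n.+1 s).

Lemma full_cycle_porbit s x : full_cycle s -> porbit s x = [set: 'I_n.+1]%SET.
Proof.
move=> /eqP full; apply/eqP; rewrite -in_set1 -full; exact: imset_f.
Qed.

Lemma full_cycle_iter s x : full_cycle s -> iter n.+1 s x = x.
Proof.
by move=> full; have := iter_porbit s x; rewrite full_cycle_porbit // cardsT card_ord.
Qed.

Lemma full_cycle_reach s x y : full_cycle s -> exists2 k, k < n.+1 & y = iter k s x.
Proof.
move=> full; have := porbit_traject s x y.
rewrite full_cycle_porbit // cardsT card_ord inE => /esym/trajectP[k lt_k ->].
by exists k.
Qed.

Lemma full_cycle_inj s x : full_cycle s -> injective (fun t : 'I_n.+1 => iter t s x).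
Proof.
move=> full t1 t2 /eqP eq_t; apply/ord_inj/eqP.
have := uniq_traject_porbit s x; rewrite full_cycle_porbit // cardsT card_ord => uniq_t.
have <- := @nth_uniq _ x _ t1 t2 _ _ uniq_t; rewrite ?size_traject //.
by rewrite !nth_traject.
Qed.

Lemma full_cycle_intro s x : (forall y, exists k, y = iter k s x) -> full_cycle s.
Proof.
move=> reach; apply/eqP/setP => X; rewrite inE.
have full y : porbit s y = [set: 'I_n.+1]%SET.
  have px : porbit s x = [set: 'I_n.+1]%SET.
    by apply/setP => z; have [k ->] := reach z; rewrite inE -permX mem_porbit.
  by rewrite -px; apply/eqP; rewrite eq_porbit_mem px inE.
by apply/imsetP/eqP => [[y _ ->]|->]; [|exists x].
Qed.

(** The permutation is increasing on each block, so two trajectories keep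
    their relative order as long as they visit the same blocks. *)
Lemma iter_increasing J s x y k :
    descents s \subset J -> x < y ->
    (forall m, m < k -> block J (iter m s x) = block J (iter m s y)) ->
  iter k s x < iter k s y.
Proof.
move=> /descents_subP inc lt_xy; elim: k => // k IH same.
by apply: inc; [apply: IH => m lt_mk; apply: same; lia | apply: same].
Qed.

(** Suppose x < y visit the same blocks for ever, and y is the p-th iterate of
    x. Then applying the p-th iterate again and again to x gives an infinite
    strictly increasing sequence. *)
Lemma trajectories_separate J s x y :
    full_cycle s -> descents s \subset J ->
    (forall k, block J (iter k s x) = block J (iter k s y)) ->
  x = y.
Proof.
move=> full sDJ.
suff H : forall x y, x < y -> (forall k, block J (iter k s x) = block J (iter k s y)) -> False.
  move=> same; case: (ltngtP x y) => [lt_xy|lt_yx|/ord_inj//].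
    by case: (H _ _ lt_xy).
  by case: (H _ _ lt_yx).
move=> {}x {}y lt_xy same; have [p _ def_y] := full_cycle_reach x y full.
have lt_iter m : iter m s x < iter m s y by apply: (iter_increasing sDJ).
have ge_m m : m <= iter (m * p) s x.
  elim: m => // m IH; apply: leq_ltn_trans IH _.
  by rewrite mulSn addnC iterD -def_y.
by have := ge_m n.+1; have := ltn_ord (iter (n.+1 * p) s x); lia.
Qed.

(** The relative order of two points of a cycle is read off from their words:
    it is decided by the first time the trajectories visit different blocks. *)
Lemma same_word_increasing J s s' x y x' y' :
    full_cycle s -> descents s \subset J -> descents s' \subset J ->
    (forall k, block J (iter k s x) = block J (iter k s' x')) ->
    (forall k, block J (iter k s y) = block J (iter k s' y')) ->
  x < y -> y' < x' -> False.
Proof.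
move=> full sDJ s'DJ eq_x eq_y lt_xy lt_yx'.
suff same k : block J (iter k s x) = block J (iter k s y).
  by have := trajectories_separate full sDJ same => eq_xy; rewrite eq_xy ltnn in lt_xy.
elim/ltn_ind: k => k same; apply/ord_inj/eqP; rewrite eqn_leq.
rewrite block_homo; last by apply/ltnW/(iter_increasing sDJ).
rewrite eq_x eq_y block_homo //; apply/ltnW/(iter_increasing s'DJ) => // m lt_mk.
by rewrite -eq_x -eq_y same.
Qed.

Definition cyclic_word w (t : nat) : 'I_n.+1 := w (inord (t %% n.+1)).

Lemma cyclic_word_ord w (t : 'I_n.+1) : cyclic_word w t = w t.
Proof. by rewrite /cyclic_word modn_small // inord_val. Qed.

Lemma cyclic_wordD w t : cyclic_word w (t + n.+1) = cyclic_word w t.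
Proof. by rewrite /cyclic_word modnDr. Qed.

Definition periodic w : bool :=
  [exists p : 'I_n.+1, (0 < p) && [forall t : 'I_n.+1, cyclic_word w (t + p) == w t]].

Lemma periodicP w :
  reflect (exists2 p, 0 < p < n.+1 & forall t, cyclic_word w (t + p) = cyclic_word w t)
          (periodic w).
Proof.
apply: (iffP existsP) => [[p /andP[p_gt0 /forallP per]]|[p /andP[p_gt0 lt_p] per]].
  exists p => [|t]; first by rewrite p_gt0 /=.
  have := per (inord (t %% n.+1)); rewrite -cyclic_word_ord => /eqP.
  rewrite inordK ?ltn_pmod // => E.
  transitivity (cyclic_word w (t %% n.+1 + p)); first by rewrite /cyclic_word modnDml.
  by rewrite E /cyclic_word modn_mod.
exists (Ordinal lt_p); rewrite p_gt0; apply/forallP => t.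
by rewrite -cyclic_word_ord per.
Qed.

Fixpoint window w (t m : nat) : nat :=
  if m is m'.+1 then window w t m' * n.+1 + cyclic_word w (t + m') else 0.

Lemma windowSl w t m :
  window w t m.+1 = cyclic_word w t * n.+1 ^ m + window w t.+1 m.
Proof.
elim: m => [|m IH]; first by rewrite /= mul0n addn0 muln1 addn0.
by rewrite [LHS]/= -/(window w t m.+1) IH /= addSnnS expnS; ring.
Qed.

Lemma window_lt w t m : window w t m < n.+1 ^ m.
Proof.
elim: m => // m IH /=; rewrite expnS.
apply: (@leq_trans ((window w t m).+1 * n.+1)); last by rewrite mulnC leq_mul2l IH orbT.
by rewrite mulSn addnC ltn_add2r.
Qed.

(** The rotation of w that starts at t, read as a number in base n.+1:
    comparing keys is comparing rotations lexicographically. *)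
Definition key w t := window w t n.+1.

Lemma key_shift w t :
  key w t.+1 + cyclic_word w t * n.+1 ^ n.+1 = key w t * n.+1 + cyclic_word w t.
Proof.
rewrite /key [window w t _]windowSl /= addSnnS cyclic_wordD expnS; ring.
Qed.

Lemma key_head w t : key w t %/ n.+1 ^ n = cyclic_word w t.
Proof.
by rewrite /key windowSl divnMDl ?expn_gt0 // divn_small ?addn0 // window_lt.
Qed.

Lemma key_inj w : ~~ periodic w -> injective (fun t : 'I_n.+1 => key w t).
Proof.
move=> prim.
suff H t1 t2 : t1 < t2 < n.+1 -> key w t1 = key w t2 -> False.
  move=> t1 t2 /= eq_k; case: (ltngtP t1 t2) => [lt_t|lt_t|/ord_inj//].
    by case: (H t1 t2) => //; rewrite lt_t ltn_ord.
  by case: (H t2 t1) => //; rewrite lt_t ltn_ord.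
move=> /andP[lt_t lt_t2] eq_k.
have eq_key m : key w (t1 + m) = key w (t2 + m).
  elim: m => [|m IH]; first by rewrite !addn0.
  rewrite !addnS; apply/eqP.
  rewrite -(eqn_add2r (cyclic_word w (t1 + m) * n.+1 ^ n.+1)) key_shift.
  by rewrite -key_head IH key_head key_shift.
case/negP: prim; apply/periodicP; exists (t2 - t1); first by lia.
move=> t; apply/ord_inj.
have [q le_q] : exists q, t1 <= t + q * n.+1.
  by exists t1; rewrite mulnS; lia.
have cwD q' u : cyclic_word w (u + q' * n.+1) = cyclic_word w u.
  by rewrite /cyclic_word addnC modnMDl.
rewrite -(cwD q) -[in RHS](cwD q) -!key_head.
have := eq_key (t + q * n.+1 - t1).
rewrite subnKC // => ->; congr (key w _ %/ _); lia.
Qed.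

(** A cyclic permutation s with a root x gives the word of the blocks visited
    by the trajectory of x. For the inverse, sort the rotations of a primitive
    word lexicographically: the ranks of the starting points identify positions
    with points, and s moves each starting point to the next one. *)
Lemma card_primitive_words J :
  n.+1 * #|[set s : 'S_n.+1 | full_cycle s && (descents s \subset J)]%SET| =
  #|[set w in words J | ~~ periodic w]%SET|.
Proof.
pose C := [set s : 'S_n.+1 | full_cycle s && (descents s \subset J)]%SET.
transitivity #|setX C [set: 'I_n.+1]%SET|.
  by rewrite cardsX cardsT card_ord mulnC.
pose f (u : 'S_n.+1 * 'I_n.+1) : {ffun 'I_n.+1 -> 'I_n.+1} :=
  [ffun t : 'I_n.+1 => block J (iter t u.1 u.2)].
have fE s x t : full_cycle s -> cyclic_word (f (s, x)) t = block J (iter t s x).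
  move=> full; rewrite /cyclic_word ffunE inordK ?ltn_pmod //=.
  congr block; rewrite [in RHS](divn_eq t n.+1) addnC iterD; congr (iter _ _ _).
  by elim: (t %/ n.+1) => // q IH; rewrite mulSn iterD -IH full_cycle_iter.
rewrite -(card_in_imset (f := f)); last first.
  move=> [s x] [s' x']; rewrite !inE /= !andbT.
  move=> /andP[full sDJ] /andP[full' s'DJ] eq_f.
  have same t k : block J (iter k s (iter t s x)) = block J (iter k s' (iter t s' x')).
    by rewrite -!iterD -!fE // eq_f.
  pose e := perm (full_cycle_inj (x := x) full).
  pose e' := perm (full_cycle_inj (x := x') full').
  (* Both enumerations of the points put the times in the same order. *)
  have ee' : e = e'.
    suff : (e^-1 * e' = 1)%g by move/(canRL (mulKVg _)); rewrite mulg1.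
    apply: increasing_perm_id => i j lt_ij; rewrite !permM ltnNge leq_eqVlt; apply/negP.
    case/orP=> [/eqP/ord_inj/perm_inj/perm_inj eq_ij|]; first by rewrite eq_ij ltnn in lt_ij.
    move: lt_ij; rewrite -{1}[i](permKV e) -{1}[j](permKV e) !permE.
    exact: same_word_increasing full sDJ s'DJ (same _) (same _).
  have eq_iter t : iter t s x = iter t s' x'.
    have [k [eq_k eq_k']] : exists k : 'I_n.+1, iter t s x = iter k s x /\ iter t s' x' = iter k s' x'.
      exists (inord (t %% n.+1)); rewrite inordK ?ltn_pmod //.
      have per u y : full_cycle u -> iter t u y = iter (t %% n.+1) u y.
        move=> fu; rewrite [in LHS](divn_eq t n.+1) addnC iterD; congr (iter _ _ _).
        by elim: (t %/ n.+1) => // q IH; rewrite mulSn iterD IH full_cycle_iter.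
      by split; apply: per.
    by rewrite eq_k eq_k'; have := congr1 (fun u : 'S_n.+1 => u k) ee'; rewrite !permE.
  have eq_x : x = x' := eq_iter 0.
  congr pair => //; apply/permP => y; have [k _ ->] := full_cycle_reach x y full.
  by rewrite -[LHS]/(iter k.+1 s x) eq_iter eq_iter.
apply: eq_card => w; rewrite inE; apply/imsetP/andP => [[[s x] sxC ->]|[wJ prim]].
  have /andP[full sDJ] : full_cycle s && (descents s \subset J).
    by move: sxC; rewrite !inE /= andbT.
  split.
    apply/wordsP; exists (perm (full_cycle_inj (x := x) full)) => t.
    by rewrite ffunE permE.
  apply/periodicP => -[p /andP[p_gt0 lt_p] per].
  have eq_px : iter p s x = x.
    apply: (trajectories_separate full sDJ) => k.
    by have := per k; rewrite !fE // iterD.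
  have := @full_cycle_inj s x full (Ordinal lt_p) ord0 eq_px.
  by move/(congr1 val) => /= p0; rewrite p0 in p_gt0.
have [r rP] := rank_perm (key_inj prim).
have w_le p q : r p < r q -> w p <= w q.
  rewrite rP => /ltnW lt_pq; rewrite -!cyclic_word_ord -!key_head.
  exact: leq_div2r.
have wE := word_sorted wJ w_le.
have rot_inj : injective (fun t : 'I_n.+1 => inord (t.+1 %% n.+1) : 'I_n.+1).
  move=> t1 t2 /(congr1 val) /=; rewrite !inordK ?ltn_pmod // => /eqP.
  rewrite -[t1.+1]addn1 -[t2.+1]addn1 eqn_modDr !modn_small // => /eqP/ord_inj //.
pose s := (r^-1 * perm rot_inj * r)%g.
have sE t : s (r t) = r (inord (t.+1 %% n.+1)) by rewrite !permM permK permE.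
have iterE t : iter t s (r ord0) = r (inord (t %% n.+1)).
  elim: t => [|t IH]; first by rewrite mod0n; congr (r _); apply/ord_inj; rewrite inordK.
  rewrite iterS IH sE inordK ?ltn_pmod //; congr (r (inord _)).
  by rewrite -addn1 modnDml addn1.
exists (s, r ord0); last first.
  apply/ffunP => t; rewrite ffunE /= iterE modn_small // inord_val wE //.
rewrite !inE /= andbT; apply/andP; split.
  apply: (@full_cycle_intro s (r ord0)) => y; exists (r^-1%g y).
  by rewrite iterE modn_small // inord_val permKV.
apply/descents_subP => i i'; rewrite -[i](permKV r) -[i'](permKV r).
move: (r^-1%g i) (r^-1%g i') => t t'; rewrite -!wE rP => lt_k eq_w.
have key_mod u : key w (inord (u %% n.+1) : 'I_n.+1) = key w u.
  rewrite inordK ?ltn_pmod // /key.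
  have win m : window w (u %% n.+1) m = window w u m.
    by elim: m => //= m ->; rewrite /cyclic_word modnDml.
  exact: win.
rewrite !sE rP !key_mod -(ltn_add2r (cyclic_word w t * n.+1 ^ n.+1)) key_shift.
rewrite !cyclic_word_ord eq_w -[w t' in X in _ < X]cyclic_word_ord key_shift cyclic_word_ord.
by rewrite ltn_add2r ltn_mul2r.
Qed.

End Necklaces.

(** * Inclusion-exclusion and periodic words *)

(** Inclusion-exclusion over the subsets of K, with absolute values taken at
    once. Moving one element k from K to L replaces the constraint that k lies
    in D x by the difference of no constraint and its negation. *)
Lemma inclusion_exclusion_bound (R : numDomainType) (T U : finType)
    (D : T -> {set U}) (a : T -> R) (e : {set U} -> R) (K L : {set U}) :
    (forall J : {set U}, `|\sum_(x | D x \subset J) a x| <= e J)%R ->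
    [disjoint K & L] ->
  (`|\sum_(x | (K \subset D x) && (D x \subset K :|: L)) a x|
    <= \sum_(J : {set U} | (L \subset J) && (J \subset K :|: L)) e J)%R.
Proof.
move=> le_e; move: {2}#|K| (leqnn #|K|) => m; elim: m K L => [|m IH] K L.
  rewrite leqn0 cards_eq0 => /eqP-> _; rewrite set0U.
  have -> : (\sum_(J : {set U} | (L \subset J) && (J \subset L)) e J = e L)%R.
    by apply: big_pred1 => J; rewrite /= eqEsubset andbC.
  by under eq_bigl => x do rewrite sub0set /=.
move=> leK disj; have [->|/set0Pn[k kK]] := eqVneq K set0.
  by apply: IH; rewrite ?cards0 // disjoints_subset sub0set.
pose K' := K :\ k; pose L' := k |: L.
have kL : k \notin L by apply/negP => kL; have := disjointFr disj kK; rewrite kL.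
have defK : K = k |: K' by rewrite setD1K.
have subK (X : {set U}) : (K \subset X) = (k \in X) && (K' \subset X).
  by rewrite {1}defK subUset sub1set.
have kK' : k \notin K' by rewrite !inE eqxx.
have leK' : #|K'| <= m by move: leK; rewrite defK cardsU1 kK'.
have disj' : [disjoint K' & L].
  by apply: disjointWl disj; apply: subsetDl.
have disjL' : [disjoint K' & L'].
  by rewrite disjoints_subset setCU subsetI -!disjoints_subset disj' andbT disjoint_sym disjoints1.
have KL : K' :|: L' = K :|: L by rewrite defK /L' setUA [_ :|: [set k]]setUC.
have KL' : K' :|: L = (K :|: L) :\ k.
  apply/setP => x; rewrite !inE; case: (x =P k) => [->|] //=.
  by rewrite (negPf kL).
have IH1 := IH K' L' leK' disjL'; have IH2 := IH K' L leK' disj'.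
have -> : (\sum_(x | (K \subset D x) && (D x \subset K :|: L)) a x =
    \sum_(x | (K' \subset D x) && (D x \subset K' :|: L')) a x -
    \sum_(x | (K' \subset D x) && (D x \subset K' :|: L)) a x)%R.
  apply/eqP; rewrite eq_sym subr_eq; apply/eqP.
  rewrite (bigID (fun x => k \in D x)) /=; congr (_ + _)%R; apply: eq_bigl => x.
    by rewrite KL subK [LHS]andbC andbA.
  by rewrite KL KL' subsetD1 andbA.
rewrite (le_trans (ler_normB _ _)) //.
rewrite [X in (_ <= X)%R](bigID (fun J : {set U} => k \in J)) /=.
rewrite lerD //.
  apply: le_trans IH1 _; rewrite le_eqVlt; apply/orP; left; apply/eqP; apply: eq_bigl => J.
  by rewrite KL /L' subUset sub1set -andbA andbC.
apply: le_trans IH2 _; rewrite le_eqVlt; apply/orP; left; apply/eqP; apply: eq_bigl => J.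
by rewrite KL' subsetD1 andbA.
Qed.

Section Discrepancy.

Variable n : nat.
Implicit Types (J : {set 'I_n}) (w : {ffun 'I_n.+1 -> 'I_n.+1}).

Lemma block_ordT J v x : v <= block J x -> exists y, block J y = v :> nat.
Proof.
case: x => x; elim: x => [|x IH] lt_x le_v.
  exists (Ordinal lt_x); apply/eqP; rewrite eqn_leq le_v andbT.
  rewrite blockE; suff -> : [set j in J | j < 0]%SET = set0 by rewrite cards0.
  by apply/setP => j; rewrite !inE andbF.
have [j [def_x def_x']] := @consecutive n (Ordinal (ltnW lt_x)) (Ordinal lt_x) erefl.
have := block_next J j; rewrite -def_x -def_x' => eq_b.
case: (leqP v (block J (Ordinal (ltnW lt_x)))) => [/IH//|lt_v].
exists (Ordinal lt_x); apply/eqP; rewrite eqn_leq le_v andbT eq_b.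
by case: (j \in J); lia.
Qed.

Lemma words_packed J w : w \in words J -> packed_on setT w.
Proof.
move=> /wordsP[s ws]; apply/packed_onP; split=> x; last by rewrite inE.
move=> _ v; rewrite ws => /ltnW/block_ordT[y eq_y].
by exists (s^-1%g y); rewrite ?inE // ws permKV.
Qed.

Lemma words_disjoint J J' w : w \in words J -> w \in words J' -> J = J'.
Proof.
move=> /wordsP[s ws] /wordsP[s' ws'].
have eqb x : block J x = block J' x :> nat.
  apply: (@sorted_rearrangement _ (fun x => block J x) (fun x => block J' x)
                                (s^-1 * s')%g) => [||y]; try exact: block_homo.
  by rewrite permM -ws' ws permKV.
apply/setP => j.
have := block_next J j; have := block_next J' j; rewrite !eqb.
by case: (j \in J); case: (j \in J'); lia.
Qed.

Lemma sum_periodic_words :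
  \sum_(J : {set 'I_n}) #|[set w in words J | periodic w]%SET| <=
    #|[set w : {ffun 'I_n.+1 -> 'I_n.+1} | packed_on setT w && periodic w]%SET|.
Proof.
under eq_bigr => J _ do rewrite -sum1dep_card.
rewrite (exchange_big_dep (fun w => packed_on setT w && periodic w)) /=; last first.
  by move=> J w _ /andP[/words_packed-> ->].
rewrite -sum1dep_card; apply: leq_sum => w /andP[_ per].
rewrite sum1dep_card; apply/card_le1_eqP => J J'.
rewrite inE => /andP[wJ _]; rewrite inE => /andP[wJ' _].
exact: words_disjoint wJ' wJ.
Qed.

Definition below q : {set 'I_n.+1} := [set x : 'I_n.+1 | x < q]%SET.

Lemma card_below q : q <= n.+1 -> #|below q| = q.
Proof.
move=> le_q.
have widen_inj : injective (widen_ord le_q) by move=> x y /(congr1 (@nat_of_ord _)) /= /ord_inj.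
rewrite -[RHS]card_ord -(card_imset _ widen_inj).
apply: eq_card => x; rewrite inE; apply/idP/imsetP => [lt_x|[y _ ->] //=].
by exists (Ordinal lt_x) => //; apply/ord_inj.
Qed.

(** A word of period q is determined by its first q letters, and these
    already use all the letters of the word. *)
Lemma card_packed_period q : 0 < q <= n.+1 ->
  #|[set w : {ffun 'I_n.+1 -> 'I_n.+1} | packed_on setT w &&
       [forall t : 'I_n.+1, cyclic_word w (t + q) == w t]]%SET| <= num_packed n (below q).
Proof.
move=> /andP[q_gt0 le_q].
pose cut w : {ffun 'I_n.+1 -> 'I_n.+1} :=
  [ffun x : 'I_n.+1 => if x < q then w x else ord0].
have per_mod w : [forall t : 'I_n.+1, cyclic_word w (t + q) == w t] ->
    forall x : 'I_n.+1, w x = cyclic_word w (x %% q).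
  move=> /forallP per x.
  have shift k y : k * q + y < n.+1 -> cyclic_word w (k * q + y) = cyclic_word w y.
    elim: k => // k IH; rewrite mulSn -addnA addnC => lt_k.
    have lt_k' : k * q + y < n.+1 by lia.
    have /eqP := per (Ordinal lt_k'); rewrite -cyclic_word_ord /= => ->.
    exact: IH.
  rewrite -cyclic_word_ord {1}(divn_eq x q) shift //.
  by rewrite -divn_eq.
have lt_mod x : x %% q < n.+1 by apply: leq_trans (ltn_pmod x q_gt0) le_q.
rewrite -(card_in_imset (f := cut)); last first.
  move=> w1 w2; rewrite !inE => /andP[_ /per_mod p1] /andP[_ /per_mod p2] eq_c.
  apply/ffunP => x; rewrite p1 p2.
  have := congr1 (fun w : {ffun 'I_n.+1 -> 'I_n.+1} => w (Ordinal (lt_mod x))) eq_c.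
  by rewrite !ffunE /= ltn_pmod // -!cyclic_word_ord.
apply: subset_leq_card; apply/subsetP => _ /imsetP[w + ->]; rewrite !inE.
move=> /andP[/packed_onP[pw _] /per_mod per]; apply/packed_onP; split=> x.
  rewrite inE => lt_x v; rewrite ffunE lt_x => lt_v.
  have [||y _ wy] := pw x _ v => //; exists (Ordinal (lt_mod y)); first by rewrite inE ltn_pmod.
  by rewrite ffunE /= ltn_pmod // -wy (per y) -cyclic_word_ord.
by rewrite inE ffunE => /negPf->.
Qed.

(** If p is a period then so is n.+1 - p, and one of them is at most half of
    n.+1. *)
Lemma card_packed_periodic :
  #|[set w : {ffun 'I_n.+1 -> 'I_n.+1} | packed_on setT w && periodic w]%SET| <=
    \sum_(1 <= q < (n.+1)./2.+1) num_packed n (below q).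
Proof.
apply: (@leq_trans (\sum_(1 <= q < (n.+1)./2.+1)
   #|[set w : {ffun 'I_n.+1 -> 'I_n.+1} | packed_on setT w &&
       [forall t : 'I_n.+1, cyclic_word w (t + q) == w t]]%SET|)); last first.
  by apply: leq_sum_nat => q lt_q; apply: card_packed_period; lia.
under [leqRHS]eq_bigr => q _ do rewrite -sum1dep_card big_mkcondr /=.
rewrite exchange_big /= -sum1dep_card big_mkcondr /=; apply: leq_sum => w _.
case: ifP => // /periodicP[p lt_p per].
suff [q /andP[q1 q2] per_q] : exists2 q, 1 <= q < n.+1./2.+1 &
                      forall t, cyclic_word w (t + q) = cyclic_word w t.
  rewrite (@big_cat_nat _ _ _ q) ?(ltnW q2) //= [X in _ + X]big_ltn //.
  rewrite ifT; first by rewrite addnCA.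
  by apply/forallP => t; rewrite per_q cyclic_word_ord.
case: (leqP p n.+1./2) => le_p; first by exists p => //; lia.
exists (n.+1 - p); first by lia.
move=> t; rewrite -[LHS]per -addnA subnK; last by lia.
exact: cyclic_wordD.
Qed.

Lemma sum_periodic_words_bound :
  2 ^ (n.+1)./2 * (\sum_(J : {set 'I_n}) #|[set w in words J | periodic w]%SET|) <=
    (n.+1)./2 * (3 ^ (n.+1)./2 * (n.+1)./2`!).
Proof.
set m := (n.+1)./2.
apply: leq_trans (leq_mul (leqnn _) (leq_trans sum_periodic_words card_packed_periodic)) _.
rewrite big_distrr /= -/m.
rewrite -{2}[m]card_ord -sum_nat_const -(big_mkord xpredT (fun _ => 3 ^ m * m`!)) big_add1 /=.
apply: leq_sum_nat => q lt_q.
have le_q : q.+1 <= n.+1 by rewrite /m in lt_q; lia.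
have le_qm : q.+1 <= m by lia.
have := num_packed_bound n (below q.+1); rewrite card_below // => bound.
have -> : 2 ^ m = 2 ^ (m - q.+1) * 2 ^ q.+1 by rewrite -expnD subnK.
rewrite -mulnA; apply: leq_trans (leq_mul (leqnn _) bound) _.
have -> : 3 ^ m = 3 ^ (m - q.+1) * 3 ^ q.+1 by rewrite -expnD subnK.
rewrite mulnA leq_mul ?leq_fact // leq_mul2r; apply/orP; right.
by case: (m - q.+1) => // d; rewrite leq_exp2r.
Qed.

Local Notation full_cycle s := (@full_cycle n.+1 s).

(** The signed weight 1 - N [s is cyclic] sums to the number of periodic words
    over {s | D(s) contained in J}, and to beta - N beta_cyc over
    {s | D(s) = I}. *)
Lemma discrepancy_bound (R : numDomainType) (I : {set 'I_n}) :
  (2 ^+ (n.+1)./2 * `|(@beta n.+1 I)%:R - n.+1%:R * (@beta_cyc n.+1 I)%:R| <=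
     ((n.+1)./2 * (3 ^ (n.+1)./2 * (n.+1)./2`!))%:R :> R)%R.
Proof.
have := sum_periodic_words_bound; rewrite -(ler_nat R); apply: le_trans.
rewrite natrM natrX; apply: ler_wpM2l; first by rewrite exprn_ge0.
pose a (s : 'S_n.+1) : R := (1 - n.+1%:R * (full_cycle s)%:R)%R.
have sum_a (P : pred 'S_n.+1) : (\sum_(s | P s) a s =
   #|[set s | P s]%SET|%:R - n.+1%:R * #|[set s | full_cycle s && P s]%SET|%:R)%R.
  rewrite sumrB -big_distrr /= -!sum1dep_card !natr_sum; congr (_ - _ * _)%R.
  rewrite big_andbC /= big_mkcondr.
  by apply: eq_bigr => s _; case: (full_cycle s).
have IE := @inclusion_exclusion_bound R _ _ (@descent_set n.+1) a
  (fun J => #|[set w in words J | periodic w]%SET|%:R)%R I set0.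
have -> : ((@beta n.+1 I)%:R - n.+1%:R * (@beta_cyc n.+1 I)%:R =
    \sum_(s | (I \subset @descent_set n.+1 s) && (@descent_set n.+1 s \subset I :|: set0)) a s)%R.
  rewrite setU0 -/(@beta n.+1 I) (eq_bigl (fun s => @descent_set n.+1 s == I)) ?sum_a //.
  by move=> s; rewrite eqEsubset andbC.
apply: le_trans (IE _ _) _.
- move=> J; rewrite sum_a -natrM card_primitive_words card_words.
  have -> : #|words J| = #|[set w in words J | ~~ periodic w]%SET|
                        + #|[set w in words J | periodic w]%SET|.
    rewrite -(cardsID [set w | periodic w]%SET (words J)) addnC; congr (_ + _).
      by apply: eq_card => w; rewrite !inE andbC.
    by apply: eq_card => w; rewrite !inE.
  by rewrite natrD addrC addKr normr_nat.
- by rewrite disjoint_sym disjoints_subset sub0set.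
rewrite natr_sum [leRHS](bigID (fun J : {set 'I_n} => (set0 \subset J) && (J \subset I :|: set0))) /=.
by rewrite lerDl sumr_ge0.
Qed.

End Discrepancy.

(** * The relative error *)

Lemma central_bin_lower m : 0 < m -> 4 ^ m <= 2 * m * 'C(2 * m, m).
Proof.
case: m => // m _; elim: m => [//|m IH].
have bin_double k : k.+1 * 'C(2 * k.+1, k.+1) = 2 * (2 * k).+1 * 'C(2 * k, k).
  have f_gt0 : 0 < k`! * k`! by rewrite muln_gt0 fact_gt0.
  apply/eqP; rewrite -(eqn_pmul2r f_gt0) -(@eqn_pmul2l k.+1) //; apply/eqP.
  have E1 : 'C(2 * k.+1, k.+1) * (k.+1`! * k.+1`!) = (2 * k.+1)`!.
    by rewrite -(@bin_fact (2 * k.+1) k.+1) ?mul2n -?addnn ?addnK ?leq_addl.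
  have E2 : 'C(2 * k, k) * (k`! * k`!) = (2 * k)`!.
    by rewrite -(@bin_fact (2 * k) k) ?mul2n -?addnn ?addnK ?leq_addl.
  transitivity ((2 * k.+1)`!); first by rewrite -E1 factS; ring.
  have -> : 2 * k.+1 = (2 * k).+2 by lia.
  by rewrite !factS -E2; ring.
rewrite expnS -mulnA bin_double; apply: leq_trans (leq_mul (leqnn 4) IH) _.
by rewrite !mulnA leq_mul2r; apply/orP; right; lia.
Qed.

Lemma half_bin_lower N : 1 < N -> 4 ^ N./2 <= 2 * N./2 * 'C(N, N./2).
Proof.
move=> N_gt1; apply: leq_trans (@central_bin_lower N./2 _) _; first by lia.
rewrite leq_mul2l; apply/orP; right; apply: leq_bin2l; lia.
Qed.

(** 2^A (N - A)! does not increase with A, so A may be lowered to N/2 if it is larger;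
    raising a smaller A to N/2 costs at most a factor N per unit. *)
Lemma pow_fact_turns N A : A <= N - 2 -> 1 < N ->
  2 ^ A * (N - A)`! <= 2 ^ N./2 * (N - N./2)`! * N ^ (N./2 - A).
Proof.
set m := N./2 => le_A N_gt1; have [le_Am|lt_mA] := leqP A m.
  have -> : N - A = (m - A) + (N - m) by rewrite /m in le_Am *; lia.
  rewrite -mulnA leq_mul ?leq_exp2l //.
  elim: (m - A) (leq_subr A m) => [|d IH] lt_d; first by rewrite muln1.
  rewrite addSn factS expnS mulnCA leq_mul ?IH ?(ltnW lt_d) //.
  by rewrite /m in lt_d *; lia.
have -> : m - A = 0 by lia.
rewrite expn0 muln1.
elim: A le_A lt_mA => // A IH le_A; rewrite ltnS leq_eqVlt => /orP[/eqP def_m|lt_mA].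
  rewrite -def_m expnS -mulnA mulnCA leq_mul2l; apply/orP; right.
  have -> : N - m = (N - m.+1).+1 by lia.
  by rewrite factS leq_mul2r; apply/orP; right; lia.
apply: leq_trans (IH _ lt_mA); last by lia.
rewrite expnS -mulnA mulnCA leq_mul2l; apply/orP; right.
have -> : N - A = (N - A.+1).+1 by lia.
by rewrite factS leq_mul2r; apply/orP; right; lia.
Qed.

Section Deviation.

Variables (R : realType) (n : nat) (I : {set 'I_n.+1}).
Local Open Scope ring_scope.

Let N := n.+2.
Let m := N./2.
Let A := @alt n.+2 I.
Let b := @beta n.+2 I.
Let c := @beta_cyc n.+2 I.

Lemma alt_le : (A <= N - 2)%N.
Proof. by rewrite /A /alt -[leqRHS]card_ord subn2; exact: max_card. Qed.

Lemma beta_gt0 : (0 < b)%N.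
Proof.
rewrite lt0n; apply/eqP => b0; have := beta_lower_bound I.
by rewrite -/b b0 mul0n leqNgt fact_gt0.
Qed.

Lemma beta_half_lower : ('C(N, m) * m`! <= b * (2 ^ m * N ^ (m - A)))%N.
Proof.
have f_gt0 : (0 < (N - m)`!)%N by rewrite fact_gt0.
rewrite -(leq_pmul2r f_gt0) -mulnA bin_fact; last by rewrite /m /N; lia.
apply: leq_trans (beta_lower_bound I) _; rewrite -mulnA leq_mul2l; apply/orP; right.
apply: leq_trans (pow_fact_turns alt_le _) _ => //.
by rewrite mulnAC.
Qed.

Lemma deviation_bound :
  `|N%:R * c%:R / b%:R - 1| * 4 ^+ m <= 2 * m%:R ^+ 2 * 3 ^+ m * N%:R ^+ (m - A) :> R.
Proof.
have b_gt0 : 0 < b%:R :> R by rewrite ltr0n beta_gt0.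
set D := `|_|.
have defD : D * b%:R = `|b%:R - N%:R * c%:R|.
  rewrite /D -{2}(ger0_norm (ltW b_gt0)) -normrM mulrBl mul1r divfK ?gt_eqF //.
  exact: distrC.
have D_ge0 : 0 <= D by exact: normr_ge0.
have disc := discrepancy_bound R I; rewrite -/N -/m -/b -/c -defD in disc.
have low := beta_half_lower; have half := @half_bin_lower N isT; rewrite -/m in half.
have f_gt0 : 0 < (m`!)%:R :> R by rewrite ltr0n fact_gt0.
move: ('C(N, m)) (m`!) f_gt0 disc low half => C0 f0 f_gt0.
rewrite !natrM natrX => disc.
rewrite -(ler_nat R) !natrM !natrX => low; rewrite -(ler_nat R) !natrM natrX => half.
set C : R := C0%:R in low half; set f : R := f0%:R in low disc f_gt0.
set t := _ ^+ (m - A) in low *.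
have t_ge0 : 0 <= t by rewrite exprn_ge0.
have DC : D * C <= m%:R * 3 ^+ m * t.
  rewrite -(ler_pM2r f_gt0).
  have -> : D * C * f = D * (C * f) by ring.
  have -> : m%:R * 3 ^+ m * t * f = m%:R * (3 ^+ m * f) * t by ring.
  apply: le_trans (ler_wpM2l D_ge0 low) _.
  have -> : D * (b%:R * (2 ^+ m * t)) = 2 ^+ m * (D * b%:R) * t by ring.
  exact: ler_wpM2r.
apply: le_trans (ler_wpM2l D_ge0 half) _.
have m_ge0 : 0 <= 2 * m%:R :> R by rewrite mulr_ge0.
have -> : D * (2 * m%:R * C) = 2 * m%:R * (D * C) by ring.
have -> : 2 * m%:R ^+ 2 * 3 ^+ m * t = 2 * m%:R * (m%:R * 3 ^+ m * t) by ring.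
exact: ler_wpM2l m_ge0 _ _ DC.
Qed.

End Deviation.

(** * Uniform exponential decay *)

Section Asymptotics.

Variable R : realType.
Local Open Scope ring_scope.
Implicit Types (x d eps : R) (n : nat).

(** This is ln y <= y at y = x `^ d. *)
Lemma ln_le_powR x d : 0 < x -> 0 < d -> ln x <= d^-1 * x `^ d.
Proof.
move=> x_gt0 d_gt0; rewrite -ler_pdivrMl ?invr_gt0 // invrK -ln_powR.
by apply/ltW/ln_sublinear/powR_gt0.
Qed.

Lemma expR_ln_exprn x k : 0 < x -> x ^+ k = expR (k%:R * ln x).
Proof. by move=> x_gt0; rewrite expRM_natl lnK. Qed.

Let kappa : R := ln (4 / 3).

Lemma kappa_gt0 : 0 < kappa.
Proof. by apply: ln_gt0; lra. Qed.

(** Truncating eps at 1 keeps the power N^(1-eps) at least 1, so that it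
    absorbs the polynomial factor N^2 as well. The rate is kappa / 3 because
    N / 3 <= N./2 holds for all N >= 2. *)
Lemma deviation_exp_bound eps n (I : {set 'I_n.+1}) :
    0 < eps -> I \in @high_alt R eps n.+2 ->
  `|n.+2%:R * (@beta_cyc n.+2 I)%:R / (@beta n.+2 I)%:R - 1| <=
    expR (3 * (n.+2%:R `^ (1 - Num.min eps 1) * ln n.+2%:R) - kappa / 3 * n.+2%:R).
Proof.
move=> eps_gt0; rewrite inE; set N : R := n.+2%:R => high.
set d := Num.min eps 1; set P := N `^ (1 - d).
have N_ge1 : 1 <= N by rewrite ler1n.
have N_gt0 : 0 < N by apply: lt_le_trans N_ge1.
have P_ge1 : 1 <= P.
  by rewrite -(powRr0 N) ler_powR // subr_ge0 ge_min lexx orbT.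
have lnN_ge0 : 0 <= ln N by apply: ln_ge0.
have dev := deviation_bound R I; rewrite -/N in dev.
move: dev high; set D := `|_|; set m := (n.+2)./2; set A := @alt n.+2 I => dev high.
have le_m : m%:R <= N / 2.
  by rewrite ler_pdivlMr // -natrM ler_nat /m; lia.
have ge_m : N / 3 <= m%:R.
  by rewrite ler_pdivrMr // -natrM ler_nat /m; lia.
have t_le : (m - A)%:R <= P.
  case: (leqP m A) => [|/ltnW] le_mA.
    by rewrite (eqP (_ : (m - A)%N == 0%N)) ?subn_eq0 // (le_trans ler01).
  rewrite natrB // lerBlDr -lerBlDl (le_trans (lerB le_m (lexx _))) //.
  have : N `^ (1 - eps) <= P by rewrite ler_powR // lerB // ge_min lexx.
  move: high; rewrite -/N; lra.
have four_gt0 : 0 < 4 ^+ m :> R by rewrite exprn_gt0.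
have {dev} : D <= 2 * m%:R ^+ 2 * (3 / 4) ^+ m * N ^+ (m - A).
  rewrite -(ler_pM2r four_gt0) (le_trans dev) // expr_div_n le_eqVlt; apply/orP; left.
  by apply/eqP; field; rewrite gt_eqF.
move/le_trans; apply.
have -> : 3 * (P * ln N) - kappa / 3 * N = (2 * (P * ln N) - kappa / 3 * N) + P * ln N by ring.
rewrite expRD; apply: ler_pM.
- by apply: mulr_ge0; [apply: mulr_ge0|apply: exprn_ge0; lra].
- by rewrite exprn_ge0 // ltW.
- rewrite expRD; apply: ler_pM.
  + by apply: mulr_ge0.
  + by apply: exprn_ge0; lra.
  + apply: (@le_trans _ _ (N ^+ 2)).
      have m_ge0 : 0 <= m%:R :> R by [].
      by rewrite !expr2; nra.
    rewrite expR_ln_exprn // ler_expR ler_wpM2l // ler_peMl //.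
  + have q_gt0 : 0 < 3 / 4 :> R by lra.
    rewrite expR_ln_exprn // ler_expR.
    have -> : ln (3 / 4) = - kappa :> R.
      by rewrite -lnV ?posrE //; congr ln; field.
    by have := ler_wpM2l (ltW kappa_gt0) ge_m; lra.
- by rewrite expR_ln_exprn // ler_expR ler_wpM2r.
Qed.

(** With d = min(eps, 1), N^(1-d) ln N is at most 2/d N^(1-d/2), which is
    N^(-d/2) times a linear function; the threshold on N makes this factor
    small enough to leave half of the rate kappa / 3. *)
Lemma exponent_bound eps (N : R) :
    0 < eps -> 1 <= N ->
    (36 / (Num.min eps 1 * kappa)) `^ (2 / Num.min eps 1) <= N ->
  3 * (N `^ (1 - Num.min eps 1) * ln N) - kappa / 3 * N <= - (kappa / 6) * N.
Proof.
move=> eps_gt0 N_ge1; set d := Num.min eps 1 => N_large.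
have d_gt0 : 0 < d by rewrite lt_min eps_gt0 ltr01.
have N_gt0 : 0 < N by apply: lt_le_trans N_ge1.
have k_gt0 := kappa_gt0.
set M := 36 / (d * kappa) in N_large.
have M_gt0 : 0 < M by rewrite divr_gt0 // mulr_gt0.
set h := d / 2; have h_gt0 : 0 < h by rewrite divr_gt0.
set P := N `^ (1 - d); set Q := N `^ h.
have P_ge0 : 0 <= P by apply: powR_ge0.
have Q_ge : M <= Q.
  rewrite [leLHS](_ : M = (M `^ (2 / d)) `^ h).
    by apply: ge0_ler_powR; rewrite ?nnegrE ?powR_ge0 // ltW.
  rewrite -powRrM (_ : 2 / d * h = 1) ?powRr1 // ?ltW //.
  by rewrite /h; field; rewrite gt_eqF.
have PQQ : P * Q * Q = N.
  have powD r u : N `^ r * N `^ u = N `^ (r + u).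
    by rewrite powRD // (gt_eqF N_gt0) implybT.
  rewrite /P /Q !powD (_ : 1 - d + h + h = 1) ?powRr1 ?ltW //.
  by rewrite /h; field.
have lnN : ln N <= h^-1 * Q by apply: ln_le_powR.
have PlnN : P * ln N <= h^-1 * (P * Q).
  by rewrite mulrCA ler_wpM2l.
have PQM : P * Q * M <= N.
  by rewrite -PQQ ler_wpM2l // mulr_ge0 // powR_ge0.
have dk : h * kappa = 18 / M by rewrite /M /h; field; rewrite !gt_eqF.
have : 3 * (P * ln N) <= kappa / 6 * N.
  apply: (@le_trans _ _ (3 * (h^-1 * (P * Q)))); first by rewrite ler_wpM2l.
  rewrite -(ler_pM2l h_gt0) -(ler_pM2r M_gt0).
  have -> : h * (3 * (h^-1 * (P * Q))) * M = 3 * (P * Q * M).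
    by field; rewrite gt_eqF.
  have -> : h * (kappa / 6 * N) * M = (h * kappa) / 6 * N * M by ring.
  rewrite dk; have -> : 18 / M / 6 * N * M = 3 * N by field; rewrite gt_eqF.
  by rewrite ler_wpM2l.
lra.
Qed.

End Asymptotics.

Local Open Scope classical_set_scope.
Local Open Scope ring_scope.

Theorem theorem5p9 (R : realType) (eps : R) (eps_gt0 : 0 < eps) :
  max_dev eps n @[n --> \oo] --> (0 : R).
Proof.
pose kappa : R := ln (4 / 3).
pose z : R := expR (- (kappa / 6)).
have z_lt1 : `|z| < 1.
  by rewrite ger0_norm ?expR_ge0 // expR_lt1 oppr_lt0 divr_gt0 // kappa_gt0.
have dev_le n : (1 < n)%N ->
    (36 / (Num.min eps 1 * kappa)) `^ (2 / Num.min eps 1) <= n%:R ->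
  max_dev eps n <= z ^+ n.
  case: n => [|[|n]] // _ n_large.
  apply: bigmax_le => [|I highI]; first by rewrite exprn_ge0 // expR_ge0.
  apply: le_trans (deviation_exp_bound eps_gt0 highI) _.
  rewrite /z -expRM_natr ler_expR.
  by apply: exponent_bound => //; rewrite ler1n.
apply: (@squeeze_cvgr _ _ _ _ (fun=> 0) (fun n => z ^+ n)); last 2 first.
- exact: cvg_cst.
- exact: cvg_expr.
near=> n; apply/andP; split; first exact: bigmax_ge_id.
apply: dev_le; first by near: n; exact: nbhs_infty_gt.
by near: n; move/cvgryPge: (@cvgr_idn R); apply.
Unshelve. all: by end_near.
Qed.
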